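(* The limit $V:=\lim_{n\to\infty}\operatorname{Var}\left(M_{[0,n-1]}\right)$ exists, and its decimal expansion begins $35.9658$, i.e. $35.9658\le V<35.9659$. Moreover $$V\ =\ 4\lim_{n\to\infty}\ \sum_{0\le i<j<n}\mathbb{P}\left(i\notin A+A\ \text{and}\ j\notin A+A\right)\ -\ 40,$$ where the series on the right converges and has exponentially decaying terms (there are constants $C>0$ and $0<\rho<1$ such that the $(i,j)$ term is at most $C\rho^{j}$ for all $0\le i<j$).
   Context: For integers $a\le b$, $[a,b]$ denotes the set of integers $x$ with $a\le x\le b$. For a set $X$ of integers, $X+X=\{x+y: x,y\in X\}$. For each $n\ge 1$, let $A$ be chosen uniformly at random among the $2^n$ subsets of $[0,n-1]$, and let $M_{[0,n-1]}:=|[0,2n-2]\setminus(A+A)|$. For $i<j<n$ the probability $\mathbb{P}(i\notin A+A\text{ and }j\notin A+A)$ depends only on $A\cap[0,j]$, and hence does not depend on $n$. *)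

(* Defs.v *)
From mathcomp Require Import all_boot all_order all_algebra.
From mathcomp Require Import reals.

Set Implicit Arguments.
Unset Strict Implicit.
Unset Printing Implicit Defensive.

Import GRing.Theory.
Local Open Scope ring_scope.

(* The uniform probability measure on a nonempty finite type T; a junk value
   (division by 0 is 0) if T is empty. *)
Definition uprob (R : realType) (T : finType) (E : pred T) : R :=
  #|E|%:R / #|T|%:R.

Definition uexpect (R : realType) (T : finType) (X : T -> R) : R :=
  (\sum_(t : T) X t) / #|T|%:R.

Definition uvariance (R : realType) (T : finType) (X : T -> R) : R :=
  uexpect (fun t => (X t - uexpect X) ^+ 2).

(* A + A, for a subset A of [0, n-1]; the sums are taken in nat, not mod n. *)
Definition sumset (n : nat) (A : {set 'I_n}) : pred nat :=
  [pred x : nat | [exists a in A, exists b in A, x == (val a + val b)%N]].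

(* M_[0,n-1] : for n >= 1, 'I_(n.*2.-1) is the integer interval [0, 2n-2]. *)
Definition missing_sums (n : nat) (A : {set 'I_n}) : nat :=
  #|[set x : 'I_(n.*2.-1) | val x \notin sumset A]|.

Definition var_missing_sums (R : realType) (n : nat) : R :=
  uvariance (fun A : {set 'I_n} => (missing_sums A)%:R).

(* P(i \notin A + A and j \notin A + A), for A uniform among the subsets of
   [0, n-1]. *)
Definition prob_both_missing (R : realType) (n i j : nat) : R :=
  uprob R (fun A : {set 'I_n} => (i \notin sumset A) && (j \notin sumset A)).

(* Main.v *)
From Stdlib Require Import NArith.
Require Import Defs.
From mathcomp Require Import all_boot all_order all_algebra.
From mathcomp Require Import zify ring lra.

(** Fix i < j and put d = j - i.  Both i and j are missing from A + A exactly
    when A is an independent set of the graph on [0, j] (with loops) that joins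
    x and y when x + y is i or j.  Following an edge of sum j and then one of
    sum i moves x to x - d, so the vertices in two residue classes r and j - r
    modulo d form a single path, visited alternately from the top of one class
    and from the bottom of the other; when the two classes coincide the path
    is folded in the middle, where it ends in a loop.  Independent sets of
    paths are counted by Fibonacci numbers, and the components multiply.

    Write j = q d + t with t < d, and e = d - 1 - t.  The t + 1 classes r <= t
    have q + 1 elements in [0, j] and are paired among themselves; the other e
    classes have q elements and are paired among themselves.  As
    j + 1 = (q + 1)(t + 1) + q e, the probability is a product
      w_(q+1)(t + 1) * w_q(e),
    where w_q(m) ([block_weight]) is 2^(-q m) times the number of independent
    sets of a block of m classes of q elements ([nb_independent_block],
    [prob_pair]).  The map from (i, j) to (q, t, e) is a bijection onto the
    triples with q >= 1, so that the double series factors level by level: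
      S = sum_(q >= 1) (W_(q+1) - 1) W_q,   W_q = sum_(m >= 0) w_q(m),
    and W_q is rational, since w_q(m + 2) / w_q(m) does not depend on m
    ([weight_total], [pair_sum_le], [pair_sum_ge]).  The terms decrease like
    0.81^q, and the first eighty of them give the required digits
    ([partial_sum_bounds], [pair_tail]).  The case q = 0 of the same formula
    gives P(x missing) = w_1(x + 1), whence sum_x P(x missing) = W_1 - 1 = 5.

    The variance is the sum of the covariances of the events that x is missing,
    over x and y in [0, 2n-2].  Reflecting A in [0, n-1] exchanges x and
    2n-2-x, hence the pairs with x, y <= n-1 and the pairs with x, y >= n-1
    contribute alike; each half tends to 5 + 2 S - 25 = 2 S - 20
    ([left_varE], [cvg_left_var]).  For x and 2n-2-y on different sides, the
    events depend on A in [0, x] and in [n-1-y, n-1]: they are independent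
    unless x + y >= n-1, and then the covariance is exponentially small in n
    ([prob_independent], [cross_cov_le]).  Hence the limit 4 S - 40. *)

(** * Independent sets of a graph *)

Section IndependentSets.
Local Open Scope nat_scope.

Definition independent {T : finType} (e : rel T) (A : {set T}) : bool :=
  [forall x in A, forall y in A, ~~ e x y].

Definition nb_independent {T : finType} (e : rel T) (D : {set T}) : nat :=
  #|[set A : {set T} | (A \subset D) && independent e A]|.

Lemma independentP (T : finType) (e : rel T) (A : {set T}) :
  reflect {in A &, forall x y, ~~ e x y} (independent e A).
Proof.
apply: (iffP forall_inP) => [h x y Ax Ay|h x Ax].
  by move/forall_inP: (h x Ax); apply.
by apply/forall_inP => y Ay; exact: h.
Qed.

Lemma eq_nb_independent (T : finType) (e e' : rel T) (D : {set T}) :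
  {in D &, e =2 e'} -> nb_independent e D = nb_independent e' D.
Proof.
move=> ee'; rewrite /nb_independent; apply: eq_card => A; rewrite !inE.
case: (boolP (A \subset D)) => //= /subsetP sAD.
by apply/independentP/independentP => h x y Ax Ay;
  [rewrite -ee'|rewrite ee']; rewrite ?h // sAD.
Qed.

Lemma nb_independent_free (T : finType) (e : rel T) (D : {set T}) :
  {in D &, forall x y, ~~ e x y} -> nb_independent e D = 2 ^ #|D|.
Proof.
move=> eD; rewrite /nb_independent -card_powerset; apply: eq_card => A.
rewrite !inE.
case: (boolP (A \subset D)) => //= /subsetP sAD.
by apply/independentP => x y /sAD Dx /sAD Dy; exact: eD.
Qed.

Lemma nb_independentU (T : finType) (e : rel T) (D1 D2 : {set T}) :
    [disjoint D1 & D2] ->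
    {in D1 & D2, forall x y, ~~ e x y && ~~ e y x} ->
  nb_independent e (D1 :|: D2) = nb_independent e D1 * nb_independent e D2.
Proof.
move=> D12 eD12; rewrite /nb_independent -cardsX.
pose h (B : {set T} * {set T}) := B.1 :|: B.2.
have split_h (B : {set T} * {set T}) : B.1 \subset D1 -> B.2 \subset D2 ->
    (h B :&: D1 = B.1) * (h B :&: D2 = B.2).
  move=> sB1 sB2; rewrite /h !setIUl; split.
    rewrite (setIidPl sB1) (_ : B.2 :&: D1 = set0) ?setU0 //.
    by apply/disjoint_setI0; rewrite disjoint_sym (disjointWr sB2).
  rewrite (setIidPl sB2) (_ : B.1 :&: D2 = set0) ?set0U //.
  by apply/disjoint_setI0; rewrite (disjointWl sB1).
rewrite -(@card_in_imset _ _ h); last first.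
  move=> [A B] [A' B']; rewrite !inE /= => /andP[/andP[sA _] /andP[sB _]].
  move=> /andP[/andP[sA' _] /andP[sB' _]] hE.
  have /= [EA EB] := split_h (A, B) sA sB.
  have /= [EA' EB'] := split_h (A', B') sA' sB'.
  by congr (_, _); [rewrite -EA hE EA'|rewrite -EB hE EB'].
apply: eq_card => A; apply/idP/imsetP.
  rewrite inE => /andP[sA /independentP iA].
  exists (A :&: D1, A :&: D2); last first.
    by rewrite /h /= -setIUr; exact/esym/setIidPl.
  rewrite !inE /= !subsetIr /=; apply/andP; split; apply/independentP => x y;
    by rewrite !inE => /andP[Ax _] /andP[Ay _]; exact: iA.
case=> -[B C]; rewrite !inE /= => /andP[/andP[sB /independentP iB]].
move=> /andP[sC /independentP iC] ->; rewrite /h /= setUSS //=.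
have BC x y : x \in B -> y \in C -> ~~ e x y && ~~ e y x.
  by move=> /(subsetP sB) Bx /(subsetP sC) Cy; exact: eD12.
apply/independentP => x y; rewrite !inE.
by move=> /orP[Bx|Cx] /orP[By|Cy]; [exact: iB|
  case/andP: (BC _ _ Bx Cy)|case/andP: (BC _ _ By Cx)|exact: iC].
Qed.

(** An independent set either omits the leaf v, or contains it and then omits
    its only neighbour w. *)
Lemma nb_independent_leaf (T : finType) (e : rel T) (v w : T) (D : {set T}) :
    v != w -> v \notin D -> w \notin D -> symmetric e ->
    ~~ e v v -> e v w -> {in D, forall x, ~~ e v x} ->
  nb_independent e (v |: (w |: D)) =
  nb_independent e (w |: D) + nb_independent e D.
Proof.
move=> vw vD wD sym_e evv evw evD; rewrite /nb_independent.
rewrite -(cardsID [set A : {set T} | v \in A]) addnC; congr (_ + _).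
  apply: eq_card => A; rewrite !inE; case: (boolP (v \in A)) => Av /=.
    apply/esym/negbTE/negP => /andP[/subsetP/(_ v Av)].
    by rewrite !inE (negbTE vw) (negbTE vD).
  congr (_ && _); apply/subsetP/subsetP => sA x Ax; last first.
    by rewrite setU1r ?sA.
  by have := sA x Ax; rewrite in_setU1 => /orP[/eqP xv|//]; rewrite -xv Ax in Av.
rewrite -[RHS](@card_in_imset _ _ (fun A => v |: A)); last first.
  move=> A B; rewrite !inE => /andP[sA _] /andP[sB _] AB.
  have vN (C : {set T}) : C \subset D -> v \notin C.
    by move=> sC; apply: contra vD; exact: subsetP.
  by rewrite -(setU1K (vN _ sA)) -(setU1K (vN _ sB)) AB.
apply: eq_card => A; rewrite !inE; apply/idP/imsetP.
  move=> /andP[/andP[/subsetP sA /independentP iA] Av].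
  exists (A :\ v); last by rewrite setD1K.
  rewrite inE; apply/andP; split.
    apply/subsetP => x /setD1P[xv Ax].
    have := sA x Ax; rewrite !inE (negbTE xv) /= => /orP[/eqP xw|//].
    by move: (iA v x Av Ax); rewrite xw evw.
  by apply/independentP => x y /setD1P[_ Ax] /setD1P[_ Ay]; exact: iA.
move=> [B]; rewrite !inE => /andP[/subsetP sB /independentP iB] ->.
rewrite setU11 andbT; apply/andP; split.
  by apply/subsetP => x; rewrite !inE => /orP[->//|/sB ->]; rewrite !orbT.
apply/independentP => x y; rewrite !inE => /orP[/eqP->|Bx] /orP[/eqP->|By] //.
- by rewrite evD ?sB.
- by rewrite sym_e evD ?sB.
- exact: iB.
Qed.

Fixpoint fib (n : nat) : nat :=
  if n is n1.+1 then (if n1 is n2.+1 then fib n1 + fib n2 else 1) else 0.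

Lemma fibSS n : fib n.+2 = fib n.+1 + fib n.
Proof. by []. Qed.

Lemma nb_independent0 (T : finType) (e : rel T) : nb_independent e set0 = 1.
Proof. by rewrite nb_independent_free ?cards0 // => x y; rewrite inE. Qed.

(** Removing the first vertex, a leaf, gives the Fibonacci recurrence.  The
    flag l puts a loop on the last vertex, which therefore counts as absent. *)
Lemma nb_independent_path (T : finType) (e : rel T) (f : nat -> T)
    (l : bool) (m : nat) :
    symmetric e -> {in gtn m &, injective f} ->
    {in gtn m &, forall a b, e (f a) (f b) =
       [|| a == b.+1, b == a.+1 | [&& l, a == m.-1 & b == m.-1]]} ->
  nb_independent e [set:: mkseq f m] = fib (m + (~~ l).+1).
Proof.
move=> sym_e; have [k] := ubnP m.
elim: k m f => // k IHk [|[|m]] f /ltnSE lemk inj_f eE.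
- by rewrite set_nil nb_independent0; clear; case: l.
- rewrite /mkseq /= set_cons set_nil setU0.
  have e00 := eE 0 0 isT isT; case: l {IHk} eE e00 => _ /= e00.
    rewrite /nb_independent; apply/eqP/cards1P; exists set0.
    apply/setP => A; rewrite !inE subset1; apply/andP/eqP => [|->].
      case=> /orP[/eqP->|/eqP//] /independentP/(_ (f 0) (f 0)).
      by rewrite !inE eqxx e00 => /(_ isT isT).
    by rewrite eqxx orbT; split=> //; apply/independentP => x y; rewrite inE.
  rewrite nb_independent_free ?cards1 //.
  by move=> x y; rewrite !inE => /eqP-> /eqP->; rewrite e00.
have consE (g : nat -> T) p :
    [set:: mkseq g p.+1] = g 0 |: [set:: mkseq (g \o S) p].
  by rewrite /mkseq /= set_cons (iotaDl 1 0 p) -map_comp.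
have sub a : a \in gtn m -> (a.+2 \in gtn m.+2) by [].
have sub1 a : a \in gtn m.+1 -> (a.+1 \in gtn m.+2) by [].
have notin a : a < 2 -> f a \notin [set:: mkseq ((f \o S) \o S) m].
  move=> a2; rewrite inE; apply/mapP => -[c]; rewrite mem_iota /= add0n => cm.
  move=> /(inj_f a c.+2) E.
  have : a = c.+2 by apply: E; rewrite !inE; lia.
  by move=> ac; rewrite ac in a2.
(* f 0 is a leaf whose neighbour is f 1. *)
rewrite (consE f) (consE (f \o S)) nb_independent_leaf //=.
- rewrite -(consE (f \o S)) !IHk //; try lia.
  + by move=> a b am bm /(inj_f a.+2 b.+2 (sub _ am) (sub _ bm)) [].
  + move=> a b am bm /=; rewrite eE ?sub // !eqSS.
    by case: m {lemk inj_f eE consE sub sub1 notin} am bm.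
  + by move=> a b am bm /(inj_f a.+1 b.+1 (sub1 _ am) (sub1 _ bm)) [].
  + by move=> a b am bm /=; rewrite eE ?sub1 // !eqSS.
- by apply/eqP => /(inj_f 0 1 isT isT).
- exact: notin.
- exact: notin.
- by rewrite eE //= andbF.
- by rewrite eE.
- move=> x; rewrite inE => /mapP[c]; rewrite mem_iota /= add0n => cm ->.
  by rewrite eE ?inE //= andbF.
Qed.
End IndependentSets.

(** * The graph of two forbidden sums *)

Section SumGraph.
Local Open Scope nat_scope.

(** The number of independent sets of [block], for m residue classes with L
    elements each: the classes are paired into paths of 2 L vertices, and for
    odd m the middle class is a path of L vertices ending in a loop. *)
Definition block_count (L m : nat) : nat :=
  fib L.*2.+2 ^ m./2 * fib L.+1 ^ odd m.

Lemma block_countSS q n : block_count q n.+2 = fib q.*2.+2 * block_count q n.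
Proof. by rewrite /block_count /= negbK expnS mulnA. Qed.

Lemma block_count0n n : block_count 0 n = 1.
Proof. by rewrite /block_count !exp1n. Qed.

(** The second condition reads x + y = j - d, and never holds for d > j: the
    value d = j + 1 thus describes the single forbidden sum j. *)
Definition sum_edge (j d : nat) : rel nat :=
  fun x y => (x + y == j) || (x + y + d == j).

Definition sum_graph (n j d : nat) : rel 'I_n := fun x y => sum_edge j d x y.

Definition block (n d a m L : nat) : {set 'I_n} :=
  [set x : 'I_n | [&& a <= x %% d, x %% d < a + m & x %/ d < L]].

(** Representations r + u d are unique when the digits r range over an
    interval of length d, wherever this interval starts. *)
Lemma eqn_digits d x u y v : x < y + d -> y < x + d ->
  (x + u * d == y + v * d) = (x == y) && (u == v).
Proof.
move=> xy yx; apply/eqP/andP => [E|[/eqP-> /eqP->]] //.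
have uv : u = v by case: (ltngtP u v) => // uv; exfalso; nia.
by move: E; rewrite uv => /addIn->.
Qed.

(** Adjacency read on quotients and remainders: the residues are
    complementary, and the quotients sum to L - 1 (total j) or L - 2
    (total j - d). *)
Lemma sum_edge_digits j d a b L r u r' v : j + d = a + b + L * d ->
    r + r' < a + b + d -> a + b < r + r' + d ->
  sum_edge j d (r + u * d) (r' + v * d) =
  (r + r' == a + b) && ((u + v + 1 == L) || (u + v + 2 == L)).
Proof.
move=> jE h1 h2; rewrite /sum_edge andb_orr -!(@eqn_digits d) // -jE !mulnDl.
by congr orb; apply/eqP/eqP; lia.
Qed.

(** The path through the classes a and b with L elements each:
    a + (L-1) d, b, a + (L-2) d, b + d, and so on. *)
Definition walk (d a b L c : nat) : nat :=
  if odd c then b + c./2 * d else a + (L - c./2.+1) * d.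

Lemma sum_graph_sym n j d : symmetric (@sum_graph n j d).
Proof. by move=> x y; rewrite /sum_graph /sum_edge addnC. Qed.

(** The walk has 2 L terms and reads the same backwards up to exchanging a and
    b.  If a = b (flag l), it is palindromic: only its first half is kept, and
    its two middle terms coincide, which makes the last kept vertex a loop. *)
Lemma sum_edge_walk j d a b L l c c' : a <= b -> b < d ->
    j + d = a + b + L * d ->
    (if l then a == b else a < b) ->
    c < (if l then L else L.*2) -> c' < (if l then L else L.*2) ->
  sum_edge j d (walk d a b L c) (walk d a b L c') =
  [|| c == c'.+1, c' == c.+1 | [&& l, c == L.-1 & c' == L.-1]].
Proof.
move=> ab bd jE lP cL c'L; rewrite /walk.
by case: ifP => oc; case: ifP => oc';
  rewrite (sum_edge_digits _ _ _ _ _ _ _ _ _ jE); try lia; case: l lP cL c'L; lia.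
Qed.

Lemma walk_inj d a b L (l : bool) : a <= b -> b < d ->
    (if l then a == b else a < b) ->
  {in gtn (if l then L else L.*2) &, injective (walk d a b L)}.
Proof.
move=> ab bd lP c c'; rewrite !inE => cL c'L; rewrite /walk.
by case: ifP => oc; case: ifP => oc' /eqP; rewrite eqn_digits;
  try lia; case: l lP cL c'L; lia.
Qed.

Lemma nb_independent_walk n j d a b L (l : bool) : a <= b -> b < d ->
    j + d = a + b + L * d -> j < n -> (if l then a == b else a < b) ->
  nb_independent (sum_graph n j d)
    [set x : 'I_n | ((x %% d == a) || (x %% d == b)) & x %/ d < L] =
  if l then fib L.+1 else fib L.*2.+2.
Proof.
case: n => // n ab bd jE jn lP.
pose f c : 'I_n.+1 := inord (walk d a b L c).
pose m := if l then L else L.*2.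
have d0 : 0 < d by lia.
have m2L : m <= L.*2 by rewrite /m; case: (l); lia.
have fE c : c < m -> val (f c) = walk d a b L c.
  move=> cm; rewrite /f /= inordK //; apply: leq_ltn_trans jn; rewrite /walk.
  have : (c./2.+1) * d <= L * d by rewrite leq_mul2r; lia.
  have : (L - c./2.+1).+1 * d <= L * d by rewrite leq_mul2r; lia.
  by rewrite !mulSn; case: ifP; lia.
rewrite (_ : [set x | _] = [set:: mkseq f m]); last first.
  apply/setP => x; rewrite !inE; apply/andP/mapP => [[xab xL]|[c]].
    (* When a = b, x is reached at an odd step if it is in the lower half. *)
    case: (boolP ((x %% d == b) && ((x %/ d).*2.+1 < m))) => [|xN].
      case/andP=> /eqP xb xm; exists (x %/ d).*2.+1.
        by rewrite mem_iota.
      apply: val_inj; rewrite fE // /walk /= odd_double /= uphalf_double -xb.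
      by rewrite addnC -divn_eq.
    have [xa xm] : x %% d = a /\ (L - (x %/ d).+1).*2 < m.
      move: (x %% d) (x %/ d) lP xab xL xN => r u; rewrite /m.
      case: (l) => /= lP xab xL xN; split; lia.
    exists (L - (x %/ d).+1).*2; first by rewrite mem_iota.
    apply: val_inj; rewrite fE // /walk /= odd_double doubleK -xa.
    by rewrite addnC (_ : L - _ = x %/ d) -?divn_eq //; lia.
  rewrite mem_iota /= add0n => cm ->; rewrite fE // /walk.
  case: ifP => oc; rewrite ?(addnC a) ?(addnC b) modnMDl divnMDl //;
    rewrite modn_small ?divn_small; lia.
rewrite (@nb_independent_path _ _ f l m).
- by rewrite /m; case: (l); rewrite ?addn1 ?addn2.
- exact: sum_graph_sym.
- move=> c c' cm c'm /(congr1 val); rewrite !fE //.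
  exact: (walk_inj d a b L l ab bd lP c c' cm c'm).
- move=> c c' cm c'm; rewrite /sum_graph !fE // (sum_edge_walk j d a b L l) //.
  by rewrite /m; case: (l).
Qed.

(** The hypothesis on j says that the extreme residues a and a + m - 1 are
    complementary.  They form one path, not joined to the residues between
    them, which are again a block for the same j, d and L. *)
Lemma nb_independent_block n j d a m L : 0 < d -> a + m <= d ->
    j + d + 1 = a.*2 + m + L * d -> j < n ->
  nb_independent (sum_graph n j d) (block n d a m L) = block_count L m.
Proof.
move=> d0; have [k] := ubnP m.
elim: k m a => // k IHk [|[|m]] a /ltnSE lemk amd jE jn.
- rewrite (_ : block _ _ _ _ _ = set0) ?nb_independent0 //.
  by apply/setP => x; rewrite !inE; lia.
- rewrite /block_count expn0 mul1n expn1 -[RHS]/(if true then fib L.+1 else 0).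
  rewrite -(@nb_independent_walk n j d a a L true) ?leqnn //; try lia.
  by congr nb_independent; apply/setP => x; rewrite !inE; lia.
- rewrite block_countSS -(IHk m a.+1); try lia.
  rewrite -[fib _]/(if false then 0 else fib L.*2.+2).
  rewrite -(@nb_independent_walk n j d a (a + m.+1) L false); try lia.
  rewrite -nb_independentU.
  + congr nb_independent; apply/setP => x; rewrite !inE.
    by case: (x %/ d < L); rewrite ?andbT ?andbF //; lia.
  + rewrite disjoint_subset; apply/subsetP => x; rewrite !inE; lia.
  + move=> x y; rewrite !inE => xP yP.
    rewrite (sum_graph_sym _ _ _ y x) andbb /sum_graph.
    rewrite (divn_eq x d) (divn_eq y d) [_ + x %% d]addnC [_ + y %% d]addnC.
    rewrite (@sum_edge_digits j d a (a + m.+1) L); try lia.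
Qed.

(** The residues up to j modulo d and those above it are two blocks without
    edges between them; the vertices above j are isolated. *)
Lemma nb_independent_sum_graph n j d : 0 < d -> d <= j.+1 -> j < n ->
  nb_independent (sum_graph n j d) [set: 'I_n] =
  block_count (j %/ d).+1 (j %% d).+1 *
  block_count (j %/ d) (d.-1 - j %% d) * 2 ^ (n - j.+1).
Proof.
move=> d0 dj jn; set q := j %/ d; set t := j %% d.
have jE : j = q * d + t := divn_eq j d.
have td : t < d by rewrite ltn_mod.
rewrite -(@nb_independent_block n j d 0 t.+1 q.+1); try lia.
rewrite -(@nb_independent_block n j d t.+1 (d.-1 - t) q); try lia.
have lo_le x : x < n -> x %% d < t.+1 -> x %/ d < q.+1 -> x <= j.
  move=> xn xt xq; rewrite (divn_eq x d) jE leq_add //.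
  by rewrite leq_mul2r; lia.
have hi_le x : x < n -> x %/ d < q -> x <= j.
  move=> xn xq; rewrite (divn_eq x d) jE.
  have : (x %/ d).+1 * d <= q * d by rewrite leq_mul2r; lia.
  by have := ltn_pmod x d0; rewrite mulSn; lia.
rewrite -nb_independentU.
- set D := _ :|: _.
  have DE : D = [set x : 'I_n | x <= j].
    apply/setP => x; rewrite !inE; apply/idP/idP => [|xj].
      case/orP => /and3P[_ xr xq]; first exact: (lo_le x (ltn_ord x)).
      exact: (hi_le x (ltn_ord x)).
    have := leq_div2r d xj; rewrite -/q leq_eqVlt => /orP[/eqP xq|xq].
      by have := divn_eq x d; rewrite xq; lia.
    by have := ltn_pmod x d0; lia.
  rewrite DE.
  have -> : n - j.+1 = #|[set x : 'I_n | j < x]|.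
    rewrite -(subnKC jn) addKn -[LHS]card_ord.
    rewrite -(card_imset xpredT (@rshift_inj j.+1 (n - j.+1))).
    apply: eq_card => x; rewrite inE; apply/imsetP/idP => [[y _ ->]|jx].
      exact: leq_addr.
    have xk : x - j.+1 < n - j.+1 by have := ltn_ord x; lia.
    by exists (Ordinal xk) => //; apply: val_inj; rewrite /= (subnKC jx).
  rewrite -(@nb_independent_free _ (sum_graph n j d)).
    rewrite -nb_independentU.
    + congr nb_independent; apply/setP => x; rewrite !inE; lia.
    + by rewrite disjoint_subset; apply/subsetP => x; rewrite !inE; lia.
    + by move=> x y; rewrite !inE /sum_graph /sum_edge; lia.
  by move=> x y; rewrite !inE /sum_graph /sum_edge; lia.
- by rewrite disjoint_subset; apply/subsetP => x; rewrite !inE; lia.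
- move=> x y; rewrite !inE => xP yP.
  rewrite (sum_graph_sym _ _ _ y x) andbb /sum_graph.
  rewrite (divn_eq x d) (divn_eq y d) [_ + x %% d]addnC [_ + y %% d]addnC.
  rewrite (@sum_edge_digits j d 0 t q.+1); try lia.
Qed.
End SumGraph.

(** * Probabilities of missing sums *)

From mathcomp Require Import reals.
Import Order.TTheory GRing.Theory Num.Theory.
Section Probabilities.
Local Open Scope ring_scope.
Variable R : realType.

Definition block_weight (L m : nat) : R := (block_count L m)%:R / 2 ^+ (L * m).

Definition sums_to (n i j : nat) : rel 'I_n :=
  fun x y => (x + y == i)%N || (x + y == j)%N.

Lemma missing_independent n (A : {set 'I_n}) i j :
  (i \notin sumset A) && (j \notin sumset A) = independent (sums_to n i j) A.
Proof.
have sumsetP x : reflect (exists a b, [/\ a \in A, b \in A & x = (a + b)%N])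
    (x \in sumset A).
  rewrite inE; apply: (iffP exists_inP) => [[a Aa /exists_inP[b Ab /eqP->]]|].
    by exists a, b.
  by move=> [a [b [Aa Ab ->]]]; exists a => //; apply/exists_inP; exists b.
apply/andP/independentP => [[iA jA] x y Ax Ay|AP].
  by apply/norP; split; [apply: contra iA|apply: contra jA] => /eqP<-;
    apply/sumsetP; exists x, y.
by split; apply/negP => /sumsetP[a [b [Aa Ab E]]];
  have := AP a b Aa Ab; rewrite /sums_to -E eqxx ?orbT.
Qed.

Lemma prob_nb_independent n i j :
  prob_both_missing R n i j =
  (nb_independent (sums_to n i j) [set: 'I_n])%:R / 2 ^+ n.
Proof.
rewrite /prob_both_missing /uprob -cardsT -powersetT card_powerset cardsT.
rewrite card_ord natrX; congr (_%:R / _); apply: eq_card => A.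
by rewrite !inE subsetT -missing_independent.
Qed.

(** The j + 1 vertices of [0, j] are shared between the two blocks as
    j + 1 = (q + 1)(t + 1) + q (d - 1 - t), so the powers of 2 split too. *)
Lemma prob_split n j d : (0 < d)%N -> (d <= j.+1)%N -> (j < n)%N ->
  (nb_independent (sum_graph n j d) [set: 'I_n])%:R / 2 ^+ n =
  block_weight (j %/ d).+1 (j %% d).+1 * block_weight (j %/ d) (d.-1 - j %% d).
Proof.
move=> d0 dj jn; rewrite nb_independent_sum_graph // /block_weight.
have td := ltn_pmod j d0.
have jE : j.+1 = ((j %/ d).+1 * (j %% d).+1 + j %/ d * (d.-1 - j %% d))%N.
  have := divn_eq j d; move: (j %/ d)%N (j %% d)%N td => q t td ->.
  set e := (d.-1 - t)%N; have -> : d = (e + t.+1)%N by lia.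
  by lia.
have -> : (2 : R) ^+ n = 2 ^+ ((j %/ d).+1 * (j %% d).+1) *
    2 ^+ (j %/ d * (d.-1 - j %% d)) * 2 ^+ (n - j.+1).
  by rewrite -!exprD -jE subnKC.
rewrite natrM (natrX _ 2) natrM.
have two_neq0 k : (2 : R) ^+ k != 0 by rewrite expf_neq0 ?pnatr_eq0.
have := two_neq0 ((j %/ d).+1 * (j %% d).+1)%N; set a := 2 ^+ _.
have := two_neq0 (j %/ d * (d.-1 - j %% d))%N; set b := 2 ^+ _.
have := two_neq0 (n - j.+1)%N; set c := 2 ^+ _ => c0 b0 a0.
by field; rewrite a0 b0 c0.
Qed.

Lemma prob_pair n i j : (i < j)%N -> (j < n)%N ->
  let d := (j - i)%N in
  prob_both_missing R n i j =
  block_weight (j %/ d).+1 (j %% d).+1 * block_weight (j %/ d) (d.-1 - j %% d).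
Proof.
move=> ij jn d; rewrite -(prob_split n) ?subn_gt0 //; last by lia.
rewrite prob_nb_independent; congr (_%:R / _); apply: eq_nb_independent => x y.
by rewrite /sums_to /sum_graph /sum_edge; lia.
Qed.

(** The single event is the case d = j + 1, where the second block is empty. *)
Lemma prob_single n j : (j < n)%N ->
  prob_both_missing R n j j = block_weight 1 j.+1.
Proof.
move=> jn; have := @prob_split n j j.+1 isT (leqnn _) jn.
rewrite divn_small // modn_small // subnn.
have -> : block_weight 0 0 = 1 by rewrite /block_weight block_count0n divr1.
rewrite mulr1 => <-.
rewrite prob_nb_independent; congr (_%:R / _); apply: eq_nb_independent => x y.
by rewrite /sums_to /sum_graph /sum_edge; lia.
Qed.

Lemma prob_sym n i j :
  prob_both_missing R n i j = prob_both_missing R n j i.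
Proof.
rewrite !prob_nb_independent; congr (_%:R / _); apply: eq_nb_independent.
by move=> x y _ _; rewrite /sums_to orbC.
Qed.

Lemma prob_ge0 n i j : 0 <= prob_both_missing R n i j.
Proof. by rewrite divr_ge0 ?ler0n. Qed.

Lemma prob_le_single n i j :
  prob_both_missing R n i j <= prob_both_missing R n j j.
Proof.
rewrite ler_pM2r; last first.
  by rewrite invr_gt0 ltr0n -cardsT -powersetT card_powerset expn_gt0.
rewrite ler_nat; apply/subset_leq_card/subsetP => A.
by rewrite !unfold_in => /andP[_ ->].
Qed.

(** The bijection is A -> n - 1 - A. *)
Lemma prob_reflect n i j : (i <= n.*2.-2)%N -> (j <= n.*2.-2)%N ->
  prob_both_missing R n (n.*2.-2 - i) (n.*2.-2 - j) =
  prob_both_missing R n i j.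
Proof.
move=> ni nj; rewrite !prob_nb_independent; congr (_%:R / _).
rewrite /nb_independent -(card_imset _ (imset_inj (@rev_ord_inj n))).
apply: eq_card => A; apply/imsetP/idP => [[B]|].
  rewrite !inE !subsetT /= => /independentP iB ->.
  apply/independentP => _ _ /imsetP[x Bx ->] /imsetP[y By ->].
  have := iB x y Bx By; rewrite /sums_to /=.
  by have := ltn_ord x; have := ltn_ord y; lia.
rewrite !inE !subsetT /= => /independentP iA.
exists (@rev_ord n @: A); last first.
  by rewrite -imset_comp (eq_imset _ rev_ordK) imset_id.
rewrite inE subsetT.
apply/independentP => _ _ /imsetP[x Ax ->] /imsetP[y Ay ->].
have := iA x y Ax Ay; rewrite /sums_to /=.
by have := ltn_ord x; have := ltn_ord y; lia.
Qed.

(** The first event only concerns the vertices up to x, and the second only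
    those above x. *)
Lemma prob_independent n x y : (x + y + 1 < n)%N ->
  prob_both_missing R n x (n.*2.-2 - y) =
  prob_both_missing R n x x * prob_both_missing R n y y.
Proof.
move=> xyn; rewrite -(@prob_reflect n y y); try lia.
set z := (n.*2.-2 - y)%N.
rewrite !prob_nb_independent.
set D := [set v : 'I_n | (v <= x)%N].
have split_D e : {in D & ~: D, forall v w, ~~ e v w && ~~ e w v} ->
    nb_independent e [set: 'I_n] =
    (nb_independent e D * nb_independent e (~: D))%N.
  by move=> ?; rewrite -nb_independentU ?setUCr // disjoints_subset setCK.
rewrite !split_D.
- rewrite (@eq_nb_independent _ (sums_to n x z) (sums_to n x x) D); last first.
    by move=> v w; rewrite !inE /sums_to /z; lia.
  rewrite (@eq_nb_independent _ (sums_to n x z) (sums_to n z z) (~: D));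
    last first.
    by move=> v w; rewrite !inE /sums_to /z; have := ltn_ord w; lia.
  rewrite (@nb_independent_free _ (sums_to n x x) (~: D)); last first.
    by move=> v w; rewrite !inE /sums_to; lia.
  rewrite (@nb_independent_free _ (sums_to n z z) D); last first.
    by move=> v w; rewrite !inE /sums_to /z; lia.
  rewrite !natrM !(natrX _ 2).
  have -> : (2 : R) ^+ n = 2 ^+ #|D| * 2 ^+ #|~: D|.
    by rewrite -exprD cardsC card_ord.
  have two_neq0 k : (2 : R) ^+ k != 0 by rewrite expf_neq0 ?pnatr_eq0.
  have := two_neq0 #|D|; set a := 2 ^+ _.
  have := two_neq0 #|~: D|; set b := 2 ^+ _ => b0 a0.
  by field; rewrite a0 b0.
- by move=> v w; rewrite !inE /sums_to /z; have := ltn_ord w; lia.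
- by move=> v w; rewrite !inE /sums_to /z; have := ltn_ord w; lia.
- by move=> v w; rewrite !inE /sums_to /z; have := ltn_ord w; lia.
Qed.
End Probabilities.

(** * Sums over the levels of the factorization *)

From mathcomp Require Import boolp classical_sets topology normedtype.
From mathcomp Require Import sequences.

Import Order.TTheory GRing.Theory Num.Theory numFieldNormedType.Exports.
Local Open Scope classical_set_scope.
Local Open Scope ring_scope.
Section Levels.
Variable R : realType.
Local Notation block_weight := (block_weight R).

Definition weight_ratio (q : nat) : R := (fib q.*2.+2)%:R / 4 ^+ q.
(** The sum of the series of [block_weight q], q >= 1: its even and its odd terms are
    two geometric series of ratio [weight_ratio q], starting with
    1 and fib q.+1 / 2 ^ q. *)
Definition weight_total (q : nat) : R :=
  (1 + (fib q.+1)%:R / 2 ^+ q) / (1 - weight_ratio q).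
Definition weight_sum (q n : nat) : R := \sum_(0 <= k < n) block_weight q k.

Lemma block_weight_ge0 q n : 0 <= block_weight q n.
Proof. by rewrite divr_ge0 ?exprn_ge0 ?ler0n. Qed.

Lemma block_weight0 q : block_weight q 0 = 1.
Proof. by rewrite /block_weight /block_count muln0 !expn0 divr1. Qed.

Lemma block_weight1 q : block_weight q 1 = (fib q.+1)%:R / 2 ^+ q.
Proof. by rewrite /block_weight /block_count muln1 expn0 mul1n expn1. Qed.

Lemma block_weightSS q n :
  block_weight q n.+2 = weight_ratio q * block_weight q n.
Proof.
rewrite /block_weight block_countSS natrM /weight_ratio -(addn2 n) mulnDr exprD.
have -> : (2 : R) ^+ (q * 2) = 4 ^+ q.
  by rewrite mulnC exprM; congr (_ ^+ _); ring.
by rewrite (mulrC (2 ^+ _)) invfM mulrACA.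
Qed.

Lemma weight_ratio_ge0 q : 0 <= weight_ratio q.
Proof. by rewrite divr_ge0 ?exprn_ge0 ?ler0n. Qed.

Lemma fib_leS n : (fib n <= fib n.+1)%N.
Proof. by case: n => // n; rewrite fibSS leq_addr. Qed.

Lemma weight_ratio_le q : (0 < q)%N -> weight_ratio q <= 3 / 4.
Proof.
case: q => // q _; rewrite ler_pdivrMr ?exprn_gt0 //.
elim: q => [|q IHq]; first by rewrite /fib /=; lra.
have fibq : (fib q.+2.*2.+2)%:R <= 3 * (fib q.+1.*2.+2)%:R :> R.
  rewrite -natrM ler_nat !doubleS.
  have := fib_leS q.*2.+3; rewrite !fibSS; lia.
have u0 : 0 <= (4 : R) ^+ q.+1 by rewrite exprn_ge0.
by rewrite exprS; lra.
Qed.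

Lemma weight_sumSS q n :
  weight_sum q n.+2 =
  1 + (fib q.+1)%:R / 2 ^+ q + weight_ratio q * weight_sum q n.
Proof.
rewrite /weight_sum !big_nat_recl //= block_weight0 block_weight1 addrA.
congr (_ + _).
by rewrite big_distrr; apply: eq_bigr => k _; rewrite block_weightSS.
Qed.

Lemma weight_totalE q : (0 < q)%N ->
  weight_total q = 1 + (fib q.+1)%:R / 2 ^+ q + weight_ratio q * weight_total q.
Proof.
move=> q0; have q1 : 1 - weight_ratio q != 0.
  by rewrite gt_eqF //; have := weight_ratio_le _ q0; lra.
rewrite /weight_total; set w := _ / 2 ^+ _; by field.
Qed.

Lemma weight_sum_ge0 q n : 0 <= weight_sum q n.
Proof. by apply: sumr_ge0 => k _; exact: block_weight_ge0. Qed.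

Lemma weight_total_ge1 q : (0 < q)%N -> 1 <= weight_total q.
Proof.
move=> q0; have := weight_ratio_le _ q0; have := weight_ratio_ge0 q.
rewrite /weight_total; set w := _ / 2 ^+ _; set r := weight_ratio q => r0 r1.
have w0 : 0 <= w by rewrite divr_ge0 ?exprn_ge0 ?ler0n.
by rewrite ler_pdivlMr; lra.
Qed.

Lemma weight_sum_le q n : (0 < q)%N -> weight_sum q n <= weight_total q.
Proof.
move=> q0; have [k] := ubnP n; elim: k n => // k IHk [|[|n]] /ltnSE nk.
- by rewrite /weight_sum big_nil (le_trans _ (weight_total_ge1 _ q0)).
- by rewrite /weight_sum big_nat1 block_weight0 weight_total_ge1.
- rewrite weight_sumSS weight_totalE // lerD2l ler_wpM2l ?weight_ratio_ge0 //.
  by rewrite IHk //; lia.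
Qed.

Lemma weight_sum_nd q : nondecreasing_seq (weight_sum q).
Proof. apply: nondecreasing_series => k _ _; exact: block_weight_ge0. Qed.

(** The limit exists by monotonicity, and satisfies the same affine equation as
    [weight_total q]. *)
Lemma cvg_weight_sum q : (0 < q)%N -> weight_sum q @ \oo --> weight_total q.
Proof.
move=> q0; have q1 : 1 - weight_ratio q != 0.
  by rewrite gt_eqF //; have := weight_ratio_le _ q0; lra.
have cU : cvgn (weight_sum q).
  apply: nondecreasing_is_cvgn; first exact: weight_sum_nd.
  by exists (weight_total q) => _ [n _ <-]; exact: weight_sum_le.
suff <- : limn (weight_sum q) = weight_total q by [].
set l := limn _.
have l2 : (fun n => weight_sum q (n + 2)%N) @ \oo --> l by rewrite cvg_shiftn.
have l2' : (fun n => weight_sum q (n + 2)%N) @ \oo -->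
    1 + (fib q.+1)%:R / 2 ^+ q + weight_ratio q * l.
  have -> : (fun n => weight_sum q (n + 2)%N) =
      (fun n => 1 + (fib q.+1)%:R / 2 ^+ q + weight_ratio q * weight_sum q n).
    by apply/funext => n; rewrite addn2 weight_sumSS.
  by apply: cvgD; [exact: cvg_cst|apply: cvgM => //; exact: cvg_cst].
have lE : l = 1 + (fib q.+1)%:R / 2 ^+ q + weight_ratio q * l.
  exact: (cvg_unique (@norm_hausdorff _ _) l2 l2').
by apply: (mulfI q1); rewrite !mulrBl !mul1r {1}lE {1}(weight_totalE _ q0); ring.
Qed.
End Levels.

(** * The series of pairs *)

Section PairSum.
Variable R : realType.
Local Notation block_weight := (block_weight R).

Lemma modulus_of_gap t t' d d' : (t < d -> t' < d' -> t = t' ->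
  d.-1 - t = d'.-1 - t' -> d = d')%N.
Proof. lia. Qed.

(** For i < j < n this is the probability that i and j are both missing, in a
    form where n does not occur. *)
Definition pair_prob (i j : nat) : R :=
  let d := (j - i)%N in
  block_weight (j %/ d).+1 (j %% d).+1 * block_weight (j %/ d) (d.-1 - j %% d).

Definition pair_sum (n : nat) : R :=
  \sum_(0 <= j < n) \sum_(0 <= i < j) pair_prob i j.

Lemma pair_prob_ge0 i j : 0 <= pair_prob i j.
Proof. by rewrite mulr_ge0 ?block_weight_ge0. Qed.

Lemma ler_sum_inj (I J : finType) (A : pred I) (B : pred J) (h : I -> J)
    (F : J -> R) :
    {in A &, injective h} -> (forall i, A i -> B (h i)) ->
    (forall j, 0 <= F j) ->
  \sum_(i | A i) F (h i) <= \sum_(j | B j) F j.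
Proof.
move=> inj_h AB F0.
have -> : \sum_(i | A i) F (h i) = \sum_(j in [set h x | x in A]%SET) F j.
  by rewrite big_imset.
rewrite [leRHS](bigID (mem [set h x | x in A]%SET)) /=.
rewrite [X in X + _](eq_bigl (mem [set h x | x in A]%SET)).
  by rewrite lerDl sumr_ge0.
move=> j /=; apply/andP/idP => [[]//|hj]; split=> //.
by case/imsetP: hj => i /AB ? ->.
Qed.

Lemma pair_sum_ord n :
  pair_sum n = \sum_(p : 'I_n * 'I_n | (p.1 < p.2)%N) pair_prob p.1 p.2.
Proof.
rewrite /pair_sum big_mkord.
transitivity (\sum_(j < n) \sum_(i < n | (i < j)%N) pair_prob i j).
  apply: eq_bigr => j _; rewrite big_mkord.
  by rewrite (big_ord_widen n (fun i => pair_prob i j)) // ltnW.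
rewrite (exchange_big_dep xpredT) //= pair_big_dep /=.
by apply: eq_bigl => p.
Qed.

Lemma box_sum (f : nat -> nat -> R) (g : nat -> nat -> R) Q N :
  \sum_(p : 'I_Q * ('I_N * 'I_N) | (0 < p.1)%N) (f p.1 p.2.1 * g p.1 p.2.2) =
  \sum_(1 <= q < Q) (\sum_(0 <= t < N) f q t) * (\sum_(0 <= e < N) g q e).
Proof.
transitivity (\sum_(q < Q | (0 < q)%N)
    \sum_(p : 'I_N * 'I_N) f q p.1 * g q p.2).
  by rewrite pair_big_dep; apply: eq_bigl => p; rewrite andbT.
pose F q := (\sum_(0 <= t < N) f q t) * (\sum_(0 <= e < N) g q e).
have -> : \sum_(1 <= q < Q) (\sum_(0 <= t < N) f q t) *
    (\sum_(0 <= e < N) g q e) = \sum_(0 <= q < Q | (0 < q)%N) F q.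
  case: Q => [|Q]; first by rewrite !big_geq.
  rewrite [RHS]big_mkcond [RHS]big_nat_recl //= add0r.
  by rewrite [LHS]big_add1 /=; apply: eq_bigr.
rewrite big_mkord; apply: eq_bigr => q _.
rewrite /F !big_mkord big_distrlr /= pair_bigA /=.
by apply: eq_bigr.
Qed.

Lemma sum_block_weightS q n :
  \sum_(0 <= t < n) block_weight q t.+1 = weight_sum R q n.+1 - 1.
Proof. by rewrite /weight_sum big_nat_recl // block_weight0 addrC addKr. Qed.

(** The contribution of all pairs i < j with j %/ (j - i) = q. *)
Definition pair_term (q : nat) : R :=
  (weight_total R q.+1 - 1) * weight_total R q.

(** (i, j) -> (q, t, e) is injective into the box [0, n)^3, and the sum over
    the box factors. *)
Lemma pair_sum_le n : pair_sum n <= \sum_(1 <= q < n) pair_term q.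
Proof.
case: n => [|n]; first by rewrite /pair_sum !big_geq.
apply: (@le_trans _ _ (\sum_(1 <= q < n.+1)
    (\sum_(0 <= t < n.+1) block_weight q.+1 t.+1) *
    (\sum_(0 <= e < n.+1) block_weight q e))).
  rewrite pair_sum_ord -(box_sum (fun q t => block_weight q.+1 t.+1)).
  pose h (p : 'I_n.+1 * 'I_n.+1) : 'I_n.+1 * ('I_n.+1 * 'I_n.+1) :=
    let d := (p.2 - p.1)%N in
    (inord (p.2 %/ d), (inord (p.2 %% d), inord (d.-1 - p.2 %% d))).
  have hE (p : 'I_n.+1 * 'I_n.+1) : (p.1 < p.2)%N -> let d := (p.2 - p.1)%N in
     [/\ (h p).1 = (p.2 %/ d)%N :> nat, (h p).2.1 = (p.2 %% d)%N :> nat &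
      (h p).2.2 = (d.-1 - p.2 %% d)%N :> nat].
    move=> p12; have jn := ltn_ord p.2; split; rewrite /= inordK //.
    - by apply: leq_ltn_trans jn; exact: leq_div.
    - by apply: leq_ltn_trans jn; exact: leq_mod.
    - by lia.
  rewrite (eq_bigr (fun p => block_weight (h p).1.+1 (h p).2.1.+1 *
      block_weight (h p).1 (h p).2.2)).
    apply: (@ler_sum_inj _ _ _ _ h (fun b : 'I_n.+1 * ('I_n.+1 * 'I_n.+1) =>
      block_weight b.1.+1 b.2.1.+1 * block_weight b.1 b.2.2))
      => [p p' p12 p12' hpp'|p p12|b].
    - have [E1 E2 E3] := hE p p12; have [] := hE p' p12'.
      rewrite -hpp' E1 E2 E3 => F1 F2 F3.
      have d0 : (0 < p.2 - p.1)%N by rewrite subn_gt0.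
      have d0' : (0 < p'.2 - p'.1)%N by rewrite subn_gt0.
      have dd : (p.2 - p.1 = p'.2 - p'.1)%N.
        by apply: modulus_of_gap F2 F3; rewrite ltn_pmod.
      have j_eq : p.2 = p'.2 :> nat.
        rewrite (divn_eq p.2 (p.2 - p.1)) (divn_eq p'.2 (p'.2 - p'.1)).
        by rewrite F1 F2 dd.
      case: p p' p12 p12' dd j_eq {hpp' E1 E2 E3 F1 F2 F3 d0 d0'}
        => i j [i' j'] /=.
      move=> ij ij' dd jj'; congr (_, _); apply: val_inj => //=.
      by move: ij ij'; rewrite !unfold_in /=; lia.
    - have [-> _ _] := hE p p12; rewrite divn_gt0 ?subn_gt0 //; lia.
    - by rewrite mulr_ge0 ?block_weight_ge0.
  by move=> p p12; have [-> -> ->] := hE p p12.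
rewrite !big_nat ler_sum // => q /andP[q0 _]; rewrite sum_block_weightS.
rewrite ler_pM ?weight_sum_ge0 ?weight_sum_le ?lerD2r ?weight_sum_le //.
rewrite subr_ge0 -(block_weight0 R q.+1) /weight_sum big_nat_recl // lerDl.
by rewrite sumr_ge0 // => *; rewrite block_weight_ge0.
Qed.

(** Conversely (q, t, e) with q >= 1 comes from d = t + e + 1, j = q d + t and
    i = j - d, and j < Q * 2 N as soon as q < Q and t, e < N. *)
Lemma pair_sum_ge Q N n : (Q * N.*2 <= n)%N ->
  \sum_(1 <= q < Q) (weight_sum R q.+1 N.+1 - 1) * weight_sum R q N <=
  pair_sum n.
Proof.
move=> QNn; rewrite pair_sum_ord.
under eq_bigr do rewrite -sum_block_weightS.
rewrite -(box_sum (fun q t => block_weight q.+1 t.+1)).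
case: n QNn => [|n] QNn.
  rewrite big1 ?sumr_ge0 // => [p _|[q [t e]] _]; first by rewrite pair_prob_ge0.
  by have := ltn_ord q; have := ltn_ord t; nia.
pose h (b : 'I_Q * ('I_N * 'I_N)) : 'I_n.+1 * 'I_n.+1 :=
  (inord (b.1 * (b.2.1 + b.2.2 + 1) + b.2.1 - (b.2.1 + b.2.2 + 1)),
   inord (b.1 * (b.2.1 + b.2.2 + 1) + b.2.1)).
have hE (b : 'I_Q * ('I_N * 'I_N)) :
    (h b).2 = (b.1 * (b.2.1 + b.2.2 + 1) + b.2.1)%N :> nat /\
    (h b).1 = (b.1 * (b.2.1 + b.2.2 + 1) + b.2.1 - (b.2.1 + b.2.2 + 1))%N :> nat.
  have : (b.1 * (b.2.1 + b.2.2 + 1) + b.2.1 < n.+1)%N.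
    case: b => q [t e] /=.
    by have := ltn_ord q; have := ltn_ord t; have := ltn_ord e; nia.
  by move=> jn; split; rewrite /= inordK //; lia.
have dE (b : 'I_Q * ('I_N * 'I_N)) : (0 < b.1)%N ->
    ((h b).2 - (h b).1 = b.2.1 + b.2.2 + 1)%N.
  by move=> q0; have [-> ->] := hE b; nia.
have qE (b : 'I_Q * ('I_N * 'I_N)) : (0 < b.1)%N ->
    ((h b).2 %/ ((h b).2 - (h b).1) = b.1)%N.
  by move=> q0; rewrite dE // (hE b).1 divnMDl ?divn_small; lia.
have tE (b : 'I_Q * ('I_N * 'I_N)) : (0 < b.1)%N ->
    ((h b).2 %% ((h b).2 - (h b).1) = b.2.1)%N.
  by move=> q0; rewrite dE // (hE b).1 modnMDl modn_small; lia.
rewrite (eq_bigr (fun b => pair_prob (h b).1 (h b).2)).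
  apply: (@ler_sum_inj _ _ _ _ h
    (fun p : 'I_n.+1 * 'I_n.+1 => pair_prob p.1 p.2))
    => [b b' b0 b0' hb|b b0|p]; last exact: pair_prob_ge0.
    have := dE b b0; have := qE b b0; have := tE b b0.
    rewrite hb tE // qE // dE // => t q d.
    case: b b' {b0 b0' hb} t q d => [q [t e]] [q' [t' e']] /= tt qq dd.
    by congr (_, (_, _)); apply: val_inj => /=; lia.
  have [-> ->] := hE b; nia.
move=> b b0; rewrite /pair_prob qE // tE // dE //.
by congr (_ * block_weight _ _); lia.
Qed.
End PairSum.

(** * The value of the series of pairs *)

(** The first eighty terms are bounded in fixed-point arithmetic on binary
    numbers, where the computation is feasible. *)
Fixpoint fib_pair (n : nat) : N * N :=
  if n is n'.+1 then let: (a, b) := fib_pair n' in (b, N.add a b)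
  else (0%num, 1%num).

Definition fibN (n : nat) : N := (fib_pair n).1.

Lemma fibNE n : N.to_nat (fibN n) = fib n.
Proof.
suff [] : N.to_nat (fib_pair n).1 = fib n /\ N.to_nat (fib_pair n).2 = fib n.+1.
  by [].
elim: n => // n [IH1 IH2]; rewrite [fib_pair _]/=.
move: IH1 IH2; case: (fib_pair n) => a b /= aE bE; split=> //.
by rewrite N2Nat.inj_add aE bE addnC.
Qed.

Definition pow2N (n : nat) : N := N.pow 2 (N.of_nat n).

Lemma pow2NE n : N.to_nat (pow2N n) = (2 ^ n)%N.
Proof.
rewrite /pow2N N2Nat.inj_pow Nat2N.id; elim: n => // n IHn.
by rewrite expnS -IHn.
Qed.

(** [term_numN q / term_denN q] is [pair_term q], both factors being reduced to
    the denominators 4 ^ q.+1 - fib (2 q + 4) and 4 ^ q - fib (2 q + 2). *)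
Definition term_numN (q : nat) : N :=
  N.mul (N.add (N.mul (pow2N q.+1) (fibN q.+2)) (fibN q.*2.+4))
        (N.add (pow2N q.*2) (N.mul (pow2N q) (fibN q.+1))).

Definition term_denN (q : nat) : N :=
  N.mul (N.sub (pow2N q.*2.+2) (fibN q.*2.+4))
        (N.sub (pow2N q.*2) (fibN q.*2.+2)).

(** Twelve decimals: the eighty rounding errors stay below 10 ^ -10. *)
Definition scaleN : N := 1000000000000%num.

Definition term_floorN (q : nat) : N :=
  N.div (N.mul scaleN (term_numN q)) (term_denN q).

Fixpoint floor_sumN (n : nat) : N :=
  if n is n'.+1 then N.add (floor_sumN n') (term_floorN n) else 0%num.

Section Numerics.
Variable R : realType.

Definition real_of_N (x : N) : R := (N.to_nat x)%:R.

Lemma real_of_ND x y : real_of_N (N.add x y) = real_of_N x + real_of_N y.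
Proof. by rewrite /real_of_N N2Nat.inj_add natrD. Qed.

Lemma real_of_NM x y : real_of_N (N.mul x y) = real_of_N x * real_of_N y.
Proof. by rewrite /real_of_N N2Nat.inj_mul natrM. Qed.

Lemma real_of_NB x y : N.le y x ->
  real_of_N (N.sub x y) = real_of_N x - real_of_N y.
Proof. by move=> yx; rewrite /real_of_N N2Nat.inj_sub natrB //; lia. Qed.

Lemma real_of_N_le x y : N.leb x y = true -> real_of_N x <= real_of_N y.
Proof. by move=> /N.leb_le xy; rewrite ler_nat; lia. Qed.

Lemma real_of_N_lt x y : N.ltb x y = true -> real_of_N x < real_of_N y.
Proof. by move=> /N.ltb_lt xy; rewrite ltr_nat; lia. Qed.

Lemma real_of_N_fib n : real_of_N (fibN n) = (fib n)%:R.
Proof. by rewrite /real_of_N fibNE. Qed.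

Lemma real_of_N_pow2 n : real_of_N (pow2N n) = 2 ^+ n.
Proof. by rewrite /real_of_N pow2NE natrX. Qed.

Lemma pow2_double q : (2 : R) ^+ q.*2 = 4 ^+ q.
Proof. by rewrite -mul2n exprM; congr (_ ^+ _); ring. Qed.

Lemma fibN_le q : (0 < q)%N -> N.le (fibN q.*2.+2) (pow2N q.*2).
Proof.
move=> q0; suff : (fib q.*2.+2 <= 2 ^ q.*2)%N by rewrite -fibNE -pow2NE; lia.
rewrite -(ler_nat R) natrX pow2_double.
have q4 : 0 < (4 : R) ^+ q by rewrite exprn_gt0.
by have := weight_ratio_le R _ q0; rewrite ler_pdivrMr //; lra.
Qed.

Lemma real_of_N_den_factor q : (0 < q)%N ->
  real_of_N (N.sub (pow2N q.*2) (fibN q.*2.+2)) =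
  4 ^+ q * (1 - weight_ratio R q).
Proof.
move=> q0; rewrite (real_of_NB _ _ (fibN_le _ q0)) real_of_N_pow2 real_of_N_fib.
rewrite pow2_double /weight_ratio.
have q4 : (4 : R) ^+ q != 0 by rewrite expf_neq0 ?pnatr_eq0.
by field.
Qed.

Lemma pair_termE q : (0 < q)%N ->
  0 < real_of_N (term_denN q) /\
  pair_term R q = real_of_N (term_numN q) / real_of_N (term_denN q).
Proof.
move=> q0; have q4 : 0 < (4 : R) ^+ q by rewrite exprn_gt0.
have q2 : 0 < (2 : R) ^+ q by rewrite exprn_gt0.
have r1 : 0 < 1 - weight_ratio R q by have := weight_ratio_le R _ q0; lra.
have r2 : 0 < 1 - weight_ratio R q.+1.
  by have := weight_ratio_le R q.+1 isT; lra.
have dE : real_of_N (term_denN q) = (4 ^+ q.+1 * (1 - weight_ratio R q.+1)) *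
    (4 ^+ q * (1 - weight_ratio R q)).
  rewrite /term_denN real_of_NM -(real_of_N_den_factor q) //.
  by rewrite -(real_of_N_den_factor q.+1).
split; first by rewrite dE !mulr_gt0 ?exprn_gt0.
rewrite dE /term_numN real_of_NM !real_of_ND !real_of_NM !real_of_N_pow2.
rewrite !real_of_N_fib pow2_double.
have E4 : (fib q.*2.+4)%:R = 4 * 4 ^+ q * weight_ratio R q.+1.
  by rewrite /weight_ratio doubleS exprS; field; rewrite gt_eqF.
have E22 : (4 : R) ^+ q = 2 ^+ q * 2 ^+ q.
  by rewrite -expr2 -exprM mulnC exprM; congr (_ ^+ _); ring.
rewrite /pair_term /weight_total E4 !exprS.
move: r1 r2 q4 q2; rewrite E22.
set r := weight_ratio R q; set r' := weight_ratio R q.+1.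
set u := 2 ^+ q => r1 r2 q4 q2; field.
by rewrite !gt_eqF.
Qed.

Lemma term_floor_bounds q : (0 < q)%N ->
  real_of_N (term_floorN q) <= real_of_N scaleN * pair_term R q
    <= real_of_N (term_floorN q) + 1.
Proof.
move=> /pair_termE[d0 ->]; rewrite mulrA ler_pdivlMr // ler_pdivrMr //.
have dN0 : term_denN q <> 0%num by move=> E; rewrite E ltxx in d0.
rewrite -[_ + 1](real_of_ND _ 1%num) -!real_of_NM.
apply/andP; split; apply: real_of_N_le; apply/N.leb_le.
  by rewrite N.mul_comm; exact: N.mul_div_le.
rewrite N.add_1_r (N.mul_comm (N.succ _)); apply/N.lt_le_incl.
exact: N.mul_succ_div_gt.
Qed.

Lemma floor_sum_bounds n :
  real_of_N (floor_sumN n) <=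
    real_of_N scaleN * \sum_(1 <= q < n.+1) pair_term R q
    <= real_of_N (floor_sumN n) + n%:R.
Proof.
elim: n => [|n /andP[lo hi]]; first by rewrite big_geq // mulr0 addr0 lexx.
have /andP[tlo thi] := term_floor_bounds n.+1 isT.
rewrite big_nat_recr //= mulrDr real_of_ND -natr1.
move: (real_of_N scaleN) (real_of_N _) (real_of_N _) (\sum_(_ <= _ < _) _)
  (pair_term _ _) (n%:R)
  lo hi tlo thi => M a b s t m.
by lra.
Qed.

(** 13 / 8 is slightly above the golden ratio: (13 / 8) ^ 2 >= 13 / 8 + 1. *)
Lemma fib_le_geom n : (fib n.+1)%:R <= (13 / 8) ^+ n :> R.
Proof.
suff [] : (fib n.+1)%:R <= (13 / 8) ^+ n :> R /\
          (fib n.+2)%:R <= (13 / 8) ^+ n.+1 :> R by [].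
elim: n => [|n [IH1 IH2]]; first by rewrite expr0 expr1 /=; split; lra.
split=> //; rewrite fibSS natrD.
have : 0 <= (13 / 8 : R) ^+ n by rewrite exprn_ge0 //; lra.
by move: IH1 IH2; rewrite !exprS; lra.
Qed.

Lemma weight_total_le_geom q : (13 / 16) ^+ q <= 1 / 1000 :> R ->
  weight_total R q <= 1 + 2 * (13 / 16) ^+ q.
Proof.
set y := (13 / 16) ^+ q => y1.
have y0 : 0 <= y by rewrite exprn_ge0 //; lra.
have w_le : (fib q.+1)%:R / 2 ^+ q <= y.
  rewrite /y -[13 / 16 as X in _ <= X ^+ _](_ : 13 / 8 / 2 = 13 / 16 :> R);
    last lra.
  by rewrite expr_div_n ler_pM2r ?invr_gt0 ?exprn_gt0 // fib_le_geom.
have r_le : weight_ratio R q <= 13 / 8 * y ^+ 2.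
  have -> : 13 / 8 * y ^+ 2 = (13 / 8) ^+ q.*2.+1 / 4 ^+ q :> R.
    have -> : y ^+ 2 = ((13 / 8) ^+ 2 / 4) ^+ q.
      by rewrite /y exprAC; congr (_ ^+ _); lra.
    by rewrite (expr_div_n ((13 / 8) ^+ 2)) (exprS _ q.*2) -mul2n (exprM _ 2) mulrA.
  by rewrite ler_pM2r ?invr_gt0 ?exprn_gt0 // fib_le_geom.
rewrite /weight_total.
move: (_ / _) (weight_ratio R q) w_le r_le => w r w_le r_le.
rewrite ler_pdivrMr; nra.
Qed.

(** Repeated squaring, rounding upwards at each step. *)
Lemma pow_small : (13 / 16) ^+ 82 <= 42 / 10 ^+ 9 :> R.
Proof.
have x2 : (13 / 16) ^+ 2 <= 661 / 10 ^+ 3 :> R by lra.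
have x4 : (13 / 16) ^+ 4 <= 436 / 1000 :> R by lra.
have x0 k : 0 <= (13 / 16 : R) ^+ k by rewrite exprn_ge0 //; lra.
have sq k (a b : R) : (13 / 16) ^+ k <= a -> a ^+ 2 <= b ->
    (13 / 16) ^+ (k * 2) <= b.
  move=> xa; apply: le_trans; rewrite exprM ler_pXn2r ?nnegrE //.
  exact: le_trans xa.
have x8 : (13 / 16) ^+ 8 <= 1901 / 10 ^+ 4 :> R.
  by apply: (sq 4 _ _ x4); clear; lra.
have x16 : (13 / 16) ^+ 16 <= 3614 / 10 ^+ 5 :> R.
  by apply: (sq 8 _ _ x8); clear; lra.
have x32 : (13 / 16) ^+ 32 <= 131 / 10 ^+ 5 :> R.
  by apply: (sq 16 _ _ x16); clear; lra.
have x64 : (13 / 16) ^+ 64 <= 1717 / 10 ^+ 9 :> R.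
  by apply: (sq 32 _ _ x32); clear; lra.
rewrite -[82%N]/(64 + 16 + 2)%N !exprD.
have h := ler_pM (x0 _) (x0 _) x64 x16.
have := ler_pM (mulr_ge0 (x0 64) (x0 16)) (x0 2) h x2.
by move/le_trans; apply; clear; lra.
Qed.

(** Each term is at most 4 (13 / 16) ^ (q + 1), since W_(q+1) - 1 is at most
    twice this power and W_q at most 2; 64 / 3 is 4 / (1 - 13 / 16). *)
Lemma pair_tail k : \sum_(81 <= q < 81 + k) pair_term R q <=
  64 / 3 * ((13 / 16) ^+ 82 - (13 / 16) ^+ (82 + k)).
Proof.
elim: k => [|k IHk]; first by rewrite !addn0 big_geq // subrr mulr0.
rewrite addnS big_nat_recr ?leq_addr //= addnS (exprS _ (82 + k)).
have x0 : 0 <= (13 / 16 : R) by lra.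
have x1 : (13 / 16 : R) <= 1 by lra.
have y1 p : (13 / 16) ^+ (82 + p) <= 1 / 2000 :> R.
  apply: le_trans (_ : (13 / 16 : R) ^+ 82 <= _).
    by rewrite exprD ler_piMr ?exprn_ge0 ?exprn_ile1.
  by apply: le_trans pow_small _; lra.
have ypos : 0 <= (13 / 16 : R) ^+ (82 + k) by rewrite exprn_ge0.
have UU : weight_total R (82 + k) <= 1 + 2 * (13 / 16) ^+ (82 + k).
  by apply: weight_total_le_geom; have := y1 k; lra.
have U1 : 1 <= weight_total R (82 + k) by exact: weight_total_ge1.
have V1 : 1 <= weight_total R (81 + k) by exact: weight_total_ge1.
have V2 : weight_total R (81 + k) <= 2.
  have yE : (13 / 16) ^+ (82 + k) = 13 / 16 * (13 / 16) ^+ (81 + k) :> R.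
    by rewrite addSn exprS.
  have y81 : (13 / 16) ^+ (81 + k) <= 1 / 1000 :> R by have := y1 k; lra.
  by apply: le_trans (weight_total_le_geom _ y81) _; lra.
have tE : pair_term R (81 + k) <= 4 * (13 / 16) ^+ (82 + k).
  rewrite /pair_term -addSn; nra.
by lra.
Qed.

Lemma pair_sum_le_hi n : pair_sum R n <=
   \sum_(1 <= q < 81) pair_term R q + 1 / 10 ^+ 6.
Proof.
have t0 q : (0 < q)%N -> 0 <= pair_term R q.
  move=> q0; rewrite mulr_ge0 ?subr_ge0 ?weight_total_ge1 //.
  exact: le_trans (weight_total_ge1 _ _ q0).
apply: le_trans (pair_sum_le _ _) _.
apply: (@le_trans _ _ (\sum_(1 <= q < 81 + n) pair_term R q)).
  case: n => [|n]; first by rewrite big_geq // big_nat sumr_ge0 // => q /andP[/t0].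
  rewrite (@big_cat_nat _ _ _ n.+1 1 (81 + n.+1)) ?leq_addl //= lerDl.
  by rewrite big_nat sumr_ge0 // => q /andP[nq _]; apply: t0; case: q nq.
rewrite (@big_cat_nat _ _ _ 81) ?leq_addr //= lerD2l.
apply: le_trans (pair_tail n) _.
have : 0 <= (13 / 16 : R) ^+ (82 + n) by rewrite exprn_ge0 //; lra.
by have := pow_small; lra.
Qed.

(** Large constants are entered digit by digit: a numeral of the ring
    stands for a unary number. *)
Definition of_digits (s : seq nat) : N :=
  foldl (fun x d => N.add (N.mul 10 x) (N.of_nat d)) 0%num s.

Lemma real_of_N_of_digits (s : seq nat) :
  real_of_N (of_digits s) = foldl (fun x d => 10 * x + d%:R) 0 s.
Proof.
rewrite /of_digits -[X in _ = foldl _ X s]/(real_of_N 0%num).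
elim: s 0%num => // d s IHs x.
have := IHs (N.add (N.mul 10 x) (N.of_nat d)); rewrite real_of_ND real_of_NM.
by rewrite (_ : real_of_N (N.of_nat d) = d%:R) // /real_of_N Nat2N.id.
Qed.

(** After division by 4 the bounds are 18.99145 and 18.991475; the sum of the
    floors, 18991471100186 in units of 10 ^ -12, leaves room for the rounding
    errors and for a tail of 10 ^ -6. *)
Lemma partial_sum_bounds :
  75 + 9 / 10 + 6 / 10 ^+ 2 + 5 / 10 ^+ 3 + 8 / 10 ^+ 4 <=
    4 * \sum_(1 <= q < 81) pair_term R q /\
  4 * (\sum_(1 <= q < 81) pair_term R q + 1 / 10 ^+ 6) <
    75 + 9 / 10 + 6 / 10 ^+ 2 + 5 / 10 ^+ 3 + 9 / 10 ^+ 4.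
Proof.
have /andP[lo hi] := floor_sum_bounds 80.
have loN : real_of_N (N.mul (of_digits [:: 1; 8; 9; 9; 1; 4; 5]) scaleN) <=
    real_of_N (N.mul (of_digits [:: 1; 0; 0; 0; 0; 0]) (floor_sumN 80)).
  by apply: real_of_N_le; vm_compute.
have hiN : real_of_N (N.add (N.mul (of_digits [:: 1; 0; 0; 0; 0; 0; 0])
      (N.add (floor_sumN 80) (of_digits [:: 8; 0]))) scaleN) <
    real_of_N (N.mul (of_digits [:: 1; 8; 9; 9; 1; 4; 7; 5]) scaleN).
  by apply: real_of_N_lt; vm_compute.
have M0 : 0 < real_of_N scaleN by exact: (@real_of_N_lt 0%num).
have := real_of_N_of_digits [:: 1; 8; 9; 9; 1; 4; 5].
have := real_of_N_of_digits [:: 1; 0; 0; 0; 0; 0].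
have := real_of_N_of_digits [:: 1; 0; 0; 0; 0; 0; 0].
have := real_of_N_of_digits [:: 8; 0].
have := real_of_N_of_digits [:: 1; 8; 9; 9; 1; 4; 7; 5].
(* The computed numbers become variables, lest they be unfolded below. *)
move: lo hi loN hiN M0; move: (floor_sumN 80) scaleN => K c.
move: (of_digits [:: 1; 8; 9; 9; 1; 4; 5]) (of_digits [:: 1; 0; 0; 0; 0; 0])
  (of_digits [:: 1; 0; 0; 0; 0; 0; 0]) (of_digits [:: 8; 0])
  (of_digits [:: 1; 8; 9; 9; 1; 4; 7; 5]) => a1 a2 a3 a4 a5.
rewrite !(real_of_NM, real_of_ND) => lo hi loN hiN M0 /= e5 e4 e3 e2 e1.
rewrite {}e1 {}e2 in loN; rewrite {}e3 {}e4 {}e5 in hiN.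
move: (real_of_N c) (real_of_N K) (\sum_(_ <= _ < _) _) lo hi loN hiN M0
  => M k s.
move=> lo hi loN hiN M0.
have loM : M * (10 ^+ 6 * s) >= M * (18 * 10 ^+ 6 + 991 * 10 ^+ 3 + 450).
  by clear hi hiN; lra.
have hiM : M * (10 ^+ 6 * s + 1) < M * (18 * 10 ^+ 6 + 991 * 10 ^+ 3 + 475).
  by clear lo loN loM; lra.
rewrite ler_pM2l // in loM; rewrite ltr_pM2l // in hiM.
by clear lo hi loN hiN; split; lra.
Qed.
End Numerics.

(** * The variance *)

Section Variance.
Variable R : realType.

Section Moments.
Variable T : finType.
Hypothesis T_gt0 : (0 < #|T|)%N.

Lemma uexpect_sum (I : Type) (r : seq I) (F : I -> T -> R) :
  uexpect (fun t => \sum_(i <- r) F i t) = \sum_(i <- r) uexpect (F i).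
Proof. by rewrite /uexpect exchange_big /= mulr_suml. Qed.

Lemma uexpect_pred (E : pred T) : uexpect (fun t => (E t)%:R) = uprob R E.
Proof.
rewrite /uexpect /uprob -sum1_card natr_sum; congr (_ / _).
rewrite [RHS]big_mkcond; apply: eq_bigr => t _.
by rewrite unfold_in; case: (E t).
Qed.

Lemma eq_uexpect (X Y : T -> R) : X =1 Y -> uexpect X = uexpect Y.
Proof. by move=> XY; rewrite /uexpect (eq_bigr Y). Qed.

Lemma uexpect_affine (X Y Z : T -> R) (a b c : R) :
  uexpect (fun t => X t + a * Y t + b * Z t + c) =
  uexpect X + a * uexpect Y + b * uexpect Z + c.
Proof.
rewrite /uexpect !big_split /= -!mulr_sumr sumr_const -[c *+ _]mulr_natr.
by field; rewrite pnatr_eq0 -lt0n.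
Qed.

Lemma uvariance_count (I : Type) (r : seq I) (B : I -> pred T) :
  uvariance (fun t => \sum_(i <- r) (B i t)%:R : R) =
  \sum_(i <- r) \sum_(j <- r)
    (uprob R (predI (B i) (B j)) - uprob R (B i) * uprob R (B j)).
Proof.
have EX : uexpect (fun t => \sum_(i <- r) (B i t)%:R) =
    \sum_(i <- r) uprob R (B i).
  by rewrite uexpect_sum; apply: eq_bigr => i _; rewrite uexpect_pred.
rewrite /uvariance EX.
transitivity (uexpect (fun t => \sum_(i <- r) \sum_(j <- r)
    ((B i t)%:R - uprob R (B i)) * ((B j t)%:R - uprob R (B j)))).
  by apply: eq_uexpect => t; rewrite -sumrB expr2 big_distrlr.
rewrite uexpect_sum; apply: eq_bigr => i _.
rewrite uexpect_sum; apply: eq_bigr => j _.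
set p := uprob R (B i); set q := uprob R (B j).
transitivity (uexpect (fun t =>
    (predI (B i) (B j) t)%:R + - q * (B i t)%:R + - p * (B j t)%:R + p * q)).
  by apply: eq_uexpect => t /=; case: (B i t); case: (B j t) => /=; ring.
by rewrite uexpect_affine !uexpect_pred -/p -/q; ring.
Qed.
End Moments.

Definition missing_cov (n x y : nat) : R := prob_both_missing R n x y -
  prob_both_missing R n x x * prob_both_missing R n y y.

Lemma var_missing_sumsE n : var_missing_sums R n =
  \sum_(0 <= x < n.*2.-1) \sum_(0 <= y < n.*2.-1) missing_cov n x y.
Proof.
have T0 : (0 < #|{set 'I_n}|)%N.
  by rewrite -cardsT -powersetT card_powerset expn_gt0.
have -> : var_missing_sums R n = uvariance (fun A : {set 'I_n} =>
    \sum_(0 <= x < n.*2.-1) (x \notin sumset A)%:R : R).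
  congr uvariance; apply/funext => A; rewrite /missing_sums -sum1_card natr_sum.
  rewrite big_mkord [LHS]big_mkcond; apply: eq_bigr => x _.
  by rewrite inE; case: (_ \notin _).
rewrite (uvariance_count _ T0 _ _
  (fun x (A : {set 'I_n}) => x \notin sumset A)).
apply: eq_bigr => x _; apply: eq_bigr => y _.
rewrite /missing_cov /prob_both_missing; congr (_ - _ * _);
  by congr uprob; apply/funext => A; rewrite andbb.
Qed.

Lemma missing_cov_sym n x y : missing_cov n x y = missing_cov n y x.
Proof. by rewrite /missing_cov prob_sym mulrC. Qed.

Lemma missing_cov_reflect n x y : (x <= n.*2.-2)%N -> (y <= n.*2.-2)%N ->
  missing_cov n (n.*2.-2 - x) (n.*2.-2 - y) = missing_cov n x y.
Proof. by move=> xn yn; rewrite /missing_cov !prob_reflect. Qed.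

(** The sum of the covariances over x, y < n, where [weight_sum R 1 n.+1 - 1]
    is the sum of the probabilities that x is missing. *)
Definition left_var (n : nat) : R :=
  (weight_sum R 1 n.+1 - 1) + 2 * pair_sum R n - (weight_sum R 1 n.+1 - 1) ^+ 2.

Lemma sum_sym_square (a : nat -> nat -> R) n : (forall x y, a x y = a y x) ->
  \sum_(0 <= x < n) \sum_(0 <= y < n) a x y =
  \sum_(0 <= x < n) a x x + 2 * \sum_(0 <= y < n) \sum_(0 <= x < y) a x y.
Proof.
move=> sym_a; elim: n => [|n IHn]; first by rewrite !big_geq // mulr0 addr0.
rewrite !big_nat_recr //= mulrDr.
under eq_bigr do rewrite big_nat_recr //=.
rewrite big_split /= IHn; under [X in _ + (X + _) = _]eq_bigr do rewrite sym_a.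
by ring.
Qed.

Lemma left_varE n k : (k <= n)%N ->
  \sum_(0 <= x < k) \sum_(0 <= y < k) missing_cov n x y = left_var k.
Proof.
move=> kn; rewrite /missing_cov /left_var -sum_block_weightS.
transitivity (\sum_(0 <= x < k) \sum_(0 <= y < k) prob_both_missing R n x y -
    (\sum_(0 <= x < k) block_weight R 1 x.+1) ^+ 2).
  rewrite expr2 big_distrlr /= -sumrB !big_nat; apply: eq_bigr => x /andP[_ xk].
  rewrite -sumrB !big_nat; apply: eq_bigr => y /andP[_ yk].
  by rewrite !prob_single //; lia.
rewrite sum_sym_square; last exact: prob_sym.
congr (_ + 2 * _ - _).
  rewrite !big_nat; apply: eq_bigr => x /andP[_ xk].
  by rewrite prob_single //; lia.
rewrite /pair_sum !big_nat; apply: eq_bigr => j /andP[_ jk].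
rewrite !big_nat; apply: eq_bigr => i /andP[_ ij].
by rewrite prob_pair //; lia.
Qed.

(** The covariances between [0, m] and [m + 1, 2 m]. *)
Definition cross_cov (m : nat) : R :=
  \sum_(0 <= x < m.+1) \sum_(0 <= y < m) missing_cov m.+1 x (m.*2 - y).

Lemma var_split m : var_missing_sums R m.+1 =
  left_var m.+1 + left_var m + 2 * cross_cov m.
Proof.
have split_sum (F : nat -> R) : \sum_(0 <= x < m.+1.*2.-1) F x =
    \sum_(0 <= x < m.+1) F x + \sum_(0 <= x < m) F (m.*2 - x)%N.
  rewrite (@big_cat_nat _ _ _ m.+1) //=; last by lia.
  congr (_ + _); rewrite -{1}[m.+1]add0n big_addn [RHS]big_nat_rev /=.
  have -> : (m.*2.+1 - m.+1 = m)%N by lia.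
  rewrite !big_nat; apply: eq_bigr => x /andP[_ xm].
  by congr F; lia.
rewrite var_missing_sumsE split_sum.
under eq_bigr do rewrite split_sum.
under [X in _ + X = _]eq_bigr do rewrite split_sum.
rewrite !big_split /= -/(cross_cov m) left_varE //.
rewrite [X in _ + (_ + X)](_ : _ = left_var m); last first.
  rewrite -(@left_varE m.+1) // !big_nat; apply: eq_bigr => x /andP[_ xm].
  rewrite !big_nat; apply: eq_bigr => y /andP[_ ym].
  by rewrite -[m.*2]/(m.+1.*2.-2) missing_cov_reflect //=; lia.
rewrite [X in _ + (X + _)](_ : _ = cross_cov m); last first.
  rewrite exchange_big; apply: eq_bigr => x _; apply: eq_bigr => y _.
  exact: missing_cov_sym.
by ring.
Qed.

(** A rate with room to spare: u ^ 8 >= 3 / 4, the ratio of the geometric decay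
    of P(x missing) in steps of 2.  Hence P(x missing) <= u ^ (4 x), and the
    square root u ^ (2 x) and the fourth root u ^ x of this bound remain
    powers of u. *)
Local Notation u := (31 / 32 : R).

Lemma block_weight1_le x : block_weight R 1 x.+1 <= u ^+ (4 * x).
Proof.
have u0 : 0 <= u by lra.
have u8 : 3 / 4 <= u ^+ 8 by lra.
have r1 : weight_ratio R 1 = 3 / 4 by rewrite /weight_ratio expr1.
have [k] := ubnP x; elim: k x => // k IHk [|[|x]] /ltnSE xk.
- by rewrite block_weight1 expr1 muln0 expr0 -[fib 2]/1%N; lra.
- by rewrite block_weightSS block_weight0 r1 muln1; lra.
- rewrite block_weightSS r1 (_ : 4 * x.+2 = 8 + 4 * x)%N; last lia.
  rewrite (exprD _ 8).
  have IH : block_weight R 1 x.+1 <= u ^+ (4 * x) by apply: IHk; clear -xk; lia.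
  by apply: ler_pM => //; [lra|exact: block_weight_ge0].
Qed.

(** A nonzero covariance needs x + y >= m.  It is then at most the smaller of
    u ^ (4 x) and u ^ (4 y), hence at most u ^ (2 (x + y)); one half of this
    exponent is spent on u ^ m, the other makes the double sum converge. *)
Lemma cross_cov_term_le m x y : (x <= m)%N -> (y < m)%N ->
  `|missing_cov m.+1 x (m.*2 - y)| <= u ^+ m * (u ^+ x * u ^+ y).
Proof.
move=> xm ym; have u0 : 0 <= u by lra.
have u1 : u <= 1 by lra.
rewrite /missing_cov -[m.*2]/(m.+1.*2.-2).
case: (ltnP (x + y + 1) m.+1) => xy.
  rewrite prob_independent // prob_reflect ?subrr ?normr0; try lia.
  by rewrite !mulr_ge0 ?exprn_ge0.
have px := block_weight1_le x; have py := block_weight1_le y.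
have bound : u ^+ (2 * (x + y)) <= u ^+ m * (u ^+ x * u ^+ y).
  by rewrite -!exprD; apply: ler_wiXn2l => //; lia.
apply: le_trans bound.
rewrite prob_reflect; try lia.
have Pxz := prob_le_single R m.+1 x (m.+1.*2.-2 - y).
have Pzx := prob_le_single R m.+1 (m.+1.*2.-2 - y) x.
rewrite prob_sym in Pzx; rewrite prob_reflect in Pxz; try lia.
rewrite !prob_single in Pxz Pzx *; try lia.
have P0 := prob_ge0 R m.+1 x (m.+1.*2.-2 - y).
have Px0 := block_weight_ge0 R 1 x.+1; have Py0 := block_weight_ge0 R 1 y.+1.
have upow_le1 k : u ^+ k <= 1 by rewrite exprn_ile1.
have Px1 := le_trans px (upow_le1 _); have Py1 := le_trans py (upow_le1 _).
have pxy : Num.min (block_weight R 1 x.+1) (block_weight R 1 y.+1) <=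
    u ^+ (2 * (x + y)).
  rewrite ge_min; case: (leqP x y) => xy'; apply/orP; [right|left].
    by apply: le_trans py _; apply: ler_wiXn2l => //; lia.
  by apply: le_trans px _; apply: ler_wiXn2l => //; lia.
apply: le_trans pxy; rewrite le_min.
move: (prob_both_missing _ _ _ _) (block_weight R 1 x.+1) (block_weight R 1 y.+1)
  Pxz Pzx P0 Px0 Py0 Px1 Py1 => P a b; clear => Pb Pa P0 a0 b0 a1 b1.
by rewrite !ler_norml; apply/andP; split; apply/andP; split; nra.
Qed.

Lemma sum_upow_le n : \sum_(0 <= k < n) u ^+ k <= 32.
Proof.
suff -> : \sum_(0 <= k < n) u ^+ k = 32 * (1 - u ^+ n).
  have : 0 <= u ^+ n by rewrite exprn_ge0 //; lra.
  by lra.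
elim: n => [|n IHn]; first by rewrite big_geq // expr0 subrr mulr0.
by rewrite big_nat_recr //= IHn exprS; lra.
Qed.

Lemma cross_cov_le m : `|cross_cov m| <= 32 ^+ 2 * u ^+ m.
Proof.
apply: le_trans (_ : \sum_(0 <= x < m.+1) \sum_(0 <= y < m)
    u ^+ m * (u ^+ x * u ^+ y) <= _).
  apply: le_trans (ler_norm_sum _ _ _) _; rewrite !big_nat.
  apply: ler_sum => x /andP[_ xm].
  apply: le_trans (ler_norm_sum _ _ _) _; rewrite !big_nat.
  by apply: ler_sum => y /andP[_ ym]; exact: cross_cov_term_le.
under eq_bigr do rewrite -mulr_sumr -mulr_sumr.
rewrite -mulr_sumr -mulr_suml mulrC.
have u0 k : 0 <= u ^+ k by rewrite exprn_ge0 //; lra.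
by rewrite ler_wpM2r // expr2 ler_pM ?sumr_ge0 ?sum_upow_le.
Qed.

Lemma cvg_cross_cov : cross_cov @ \oo --> (0 : R).
Proof.
apply/norm_cvg0P.
have geo : (fun m => 32 ^+ 2 * u ^+ m) @ \oo --> (0 : R).
  rewrite -[X in _ --> X](mulr0 (32 ^+ 2)).
  apply: cvgM; first exact: cvg_cst.
  by apply: cvg_expr; rewrite ger0_norm; lra.
apply: squeeze_cvgr (cvg_cst 0) geo.
by apply: nearW => m; rewrite normr_ge0 cross_cov_le.
Qed.

Lemma cvg_left_var (S : R) : pair_sum R @ \oo --> S ->
  left_var @ \oo --> 2 * S - 20.
Proof.
move=> cS.
have cp : (fun n => weight_sum R 1 n.+1 - 1) @ \oo --> (5 : R).
  have -> : (5 : R) = weight_total R 1 - 1.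
    rewrite /weight_total /weight_ratio !expr1 -[fib 2]/1%N -[fib 1.*2.+2]/3%N.
    by field.
  apply: cvgB; last exact: cvg_cst.
  by rewrite (@cvg_shiftS _ (weight_sum R 1)); exact: cvg_weight_sum.
have -> : 2 * S - 20 = 5 + 2 * S - 5 ^+ 2 by ring.
apply: cvgB.
  by apply: cvgD => //; apply: cvgM => //; exact: cvg_cst.
exact: (cvgM cp cp).
Qed.

Lemma cvg_var (S : R) : pair_sum R @ \oo --> S ->
  (fun n => var_missing_sums R n) @ \oo --> 4 * S - 40.
Proof.
move=> cS; rewrite -cvg_shiftS.
have -> : (fun n => var_missing_sums R n.+1) =
    (fun m => left_var m.+1 + left_var m + 2 * cross_cov m).
  by apply/funext => m; exact: var_split.
have -> : 4 * S - 40 = (2 * S - 20) + (2 * S - 20) + 2 * 0 by ring.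
have cL := cvg_left_var _ cS.
apply: cvgD; last by apply: cvgM; [exact: cvg_cst|exact: cvg_cross_cov].
by apply: cvgD => //; rewrite cvg_shiftS.
Qed.

Lemma cvgn_pair_sum : cvgn (pair_sum R).
Proof.
apply: nondecreasing_is_cvgn.
  apply: nondecreasing_series => j _ _.
  by apply: sumr_ge0 => i _; exact: pair_prob_ge0.
exists (\sum_(1 <= q < 81) pair_term R q + 1 / 10 ^+ 6) => _ [n _ <-].
exact: pair_sum_le_hi.
Qed.

(** Let N tend to infinity in [pair_sum_ge]. *)
Lemma lim_pair_sum_ge Q :
  \sum_(1 <= q < Q) pair_term R q <= limn (pair_sum R).
Proof.
have cF : (fun N => \sum_(1 <= q < Q)
    (weight_sum R q.+1 N.+1 - 1) * weight_sum R q N) @ \oo -->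
    \sum_(1 <= q < Q) pair_term R q.
  rewrite big_nat.
  have -> : (fun N => \sum_(1 <= q < Q)
      (weight_sum R q.+1 N.+1 - 1) * weight_sum R q N) =
      (fun N => \sum_(1 <= q < Q | (1 <= q < Q)%N)
      (weight_sum R q.+1 N.+1 - 1) * weight_sum R q N).
    by apply/funext => N; rewrite big_nat.
  apply: cvg_big; first exact: add_continuous.
  move=> q /andP[q0 _]; apply: cvgM; last exact: cvg_weight_sum.
  apply: cvgB; last exact: cvg_cst.
  by rewrite (@cvg_shiftS _ (weight_sum R q.+1)); exact: cvg_weight_sum.
rewrite -(cvg_lim (@Rhausdorff R) cF).
apply: limr_le; first by apply/cvg_ex; exists (\sum_(1 <= q < Q) pair_term R q).
apply: nearW => N; apply: le_trans (pair_sum_ge R Q N _ (leqnn _)) _.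
apply: nondecreasing_cvgn_le; last exact: cvgn_pair_sum.
apply: nondecreasing_series => j _ _.
by apply: sumr_ge0 => i _; exact: pair_prob_ge0.
Qed.

Lemma prob_pair_decay n i j : (i < j)%N -> (j < n)%N ->
  prob_both_missing R n i j <= 1 * (u ^+ 4) ^+ j.
Proof.
move=> ij jn; rewrite mul1r -exprM; apply: le_trans (block_weight1_le j).
by rewrite -(prob_single R n j jn) prob_le_single.
Qed.
End Variance.

Theorem theorem1p5 (R : realType) :
  exists V S : R,
    [/\ (fun n : nat => var_missing_sums R n) @ \oo --> V,
        35 + 9 / 10 + 6 / 10 ^+ 2 + 5 / 10 ^+ 3 + 8 / 10 ^+ 4 <= V
          < 35 + 9 / 10 + 6 / 10 ^+ 2 + 5 / 10 ^+ 3 + 9 / 10 ^+ 4,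
        (fun n : nat =>
           \sum_(0 <= j < n) \sum_(0 <= i < j) prob_both_missing R n i j)
          @ \oo --> S,
        V = 4 * S - 40
      & exists C rho : R,
          [/\ 0 < C, 0 < rho, rho < 1
            & forall n i j : nat, (i < j)%N -> (j < n)%N ->
                prob_both_missing R n i j <= C * rho ^+ j]].
Proof.
have cS := cvgn_pair_sum R; set S := limn (pair_sum R).
have [lo hi] := partial_sum_bounds R.
have S_ge : \sum_(1 <= q < 81) pair_term R q <= S := lim_pair_sum_ge R 81.
have S_le : S <= \sum_(1 <= q < 81) pair_term R q + 1 / 10 ^+ 6.
  by apply: limr_le => //; apply: nearW => n; exact: pair_sum_le_hi.
exists (4 * S - 40), S; split => //.
- exact: cvg_var.
- move: (\sum_(_ <= _ < _) _) S S_ge S_le lo hi; clear => s S S_ge S_le lo hi.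
  by apply/andP; split; lra.
- rewrite (_ : (fun n => _) = pair_sum R) //; apply/funext => n.
  rewrite /pair_sum !big_nat; apply: eq_bigr => j /andP[_ jn].
  by rewrite !big_nat; apply: eq_bigr => i /andP[_ ij]; rewrite prob_pair.
- exists 1, ((31 / 32) ^+ 4); split; try lra.
  exact: prob_pair_decay.
Qed.
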